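(* Let $f:\mathbb{R}^n\to\mathbb{R}\cup\{+\infty\}$ be three times continuously differentiable on $\mathrm{dom}(f)$, bounded below, and $F$-based $\kappa$-self-concordant with respect to a convex function $F:\mathbb{R}^n\to\mathbb{R}\cup\{+\infty\}$, for some $\kappa>0$. Let $x_0\in\mathrm{dom}(f)$ and let $\{x_j\}_{j\ge 0}$ be the sequence generated by the Regularized Newton's Method (RNM) started at $x_0$. Then, for every integer $k\ge 0$, $$\min_{0\le j\le k}\nu_{f,F}(x_j)\ \le\ \sqrt{\frac{2\,(1+\Gamma_f(x_0))\,\bigl(f(x_0)-\inf_{x\in\mathbb{R}^n}f(x)\bigr)}{k+1}}.$$
   Context: Notation: $\mathrm{dom}(f)=\{x\in\mathbb{R}^n: f(x)<+\infty\}$; $\nabla^2 f(x)[h,h]=h^\top\nabla^2 f(x)h$, and $\nabla^3 f(x)[h,h,h]$ is the third directional derivative of $f$ at $x$ along $h$. For $\kappa>0$, a closed convex function $g:\mathbb{R}^n\to\mathbb{R}\cup\{+\infty\}$ is $\kappa$-self-concordant if $\mathrm{dom}(g)$ is open, $g$ is three times continuously differentiable on $\mathrm{dom}(g)$, and $\nabla^3 g(x)[h,h,h]\le 2\kappa(\nabla^2 g(x)[h,h])^{3/2}$ for all $x\in\mathrm{dom}(g)$, $h\in\mathbb{R}^n$. Given $F:\mathbb{R}^n\to\mathbb{R}\cup\{+\infty\}$, the function $f$ is $F$-based $\kappa$-self-concordant if $\mathrm{dom}(f)\subseteq\mathrm{dom}(F)$, $g=f+F$ is $\kappa$-self-concordant,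 and $\nabla^2 g(x)\succ0$ for all $x\in\mathrm{dom}(f)$. RNM: starting from $x_0\in\mathrm{dom}(f)$, for $j=0,1,2,\dots$ set $d_j=-(\nabla^2(f+F)(x_j))^{-1}\nabla f(x_j)$, $\lambda_j=\sqrt{-\nabla f(x_j)^\top d_j}$, $t_j=\frac{1}{1+\kappa\lambda_j}$, $x_{j+1}=x_j+t_jd_j$. For $x\in\mathrm{dom}(f)$, $\nu_{f,F}(x)=\sqrt{d^\top\nabla^2(f+F)(x)d}$ where $d=-(\nabla^2(f+F)(x))^{-1}\nabla f(x)$ (equivalently $\nu_{f,F}(x)^2=\nabla f(x)^\top(\nabla^2(f+F)(x))^{-1}\nabla f(x)$). $\Gamma_f(x)=\sup\{t\ge0:\ t-\log(1+t)\le\kappa^2(f(x)-\inf_{z\in\mathbb{R}^n}f(z))\}$. *)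

(* Defs.v *)
From HB Require Import structures.
From mathcomp Require Import all_boot all_order all_algebra.
From mathcomp Require Import all_classical all_reals all_analysis.

Set Implicit Arguments.
Unset Strict Implicit.
Unset Printing Implicit Defensive.

Import Order.TTheory GRing.Theory Num.Theory.
Import numFieldNormedType.Exports.

Local Open Scope classical_set_scope.
Local Open Scope ring_scope.

Section Calculus.
Context {R : realType} {n : nat}.
Implicit Types (U : set 'cV[R]_n) (h : 'cV[R]_n -> R) (x v : 'cV[R]_n).

(* For open U: h is k times continuously differentiable on U. *)
Fixpoint Ck (k : nat) U h : Prop :=
  match k with
  | 0 => forall x, U x -> {for x, continuous h}
  | k'.+1 => (forall x, U x -> differentiable h x) /\
             forall v, Ck k' U ('D_v h)
  end.

Definition grad h x : 'cV[R]_n := \col_i 'D_(delta_mx i 0) h x.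

Definition hess h x : 'M[R]_n :=
  \matrix_(i, j) 'D_(delta_mx i 0) ('D_(delta_mx j 0) h) x.

Definition third_derive h x v : R := 'D_v ('D_v ('D_v h)) x.

Definition quad (A : 'M[R]_n) v : R := (v^T *m A *m v) 0 0.

(* Symmetry is not restated: only applied to Hessians of C^3 functions. *)
Definition posdef (A : 'M[R]_n) : Prop := forall v, v != 0 -> 0 < quad A v.

End Calculus.

(* A function R^n -> R U {+oo} is a map to \bar R avoiding -oo; on its domain,
   which is open wherever derivatives are used, it is identified with the
   real-valued function fine \o f. *)
Section ExtendedFunctions.
Context {R : realType} {n : nat}.
Implicit Types (f g F : 'cV[R]_n -> \bar R) (x : 'cV[R]_n) (kappa : R).

Definition dom f : set 'cV[R]_n := [set x | (f x < +oo)%E].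

Definition epigraph f : set ('cV[R]_n * R) :=
  [set p | (f p.1 <= p.2%:E)%E].

Definition econvex f : Prop :=
  forall (x y : 'cV[R]_n) (t : R), 0 <= t <= 1 ->
    (f (t *: x + (1 - t) *: y)%R
       <= t%:E * f x + (1 - t)%R%:E * f y)%E.

Definition self_concordant kappa g : Prop :=
  [/\ closed (epigraph g),
      econvex g,
      open (dom g),
      Ck 3 (dom g) (fine \o g) &
      forall x (v : 'cV[R]_n), dom g x ->
        third_derive (fine \o g) x v
          <= 2 * kappa * quad (hess (fine \o g) x) v `^ (3 / 2)].

Definition based_self_concordant kappa F f : Prop :=
  [/\ dom f `<=` dom F,
      self_concordant kappa (f \+ F)%E &
      forall x, dom f x -> posdef (hess (fine \o (f \+ F)%E) x)].

Definition rnm_dir f F x : 'cV[R]_n :=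
  - (invmx (hess (fine \o (f \+ F)%E) x) *m grad (fine \o f) x).

Definition rnm_lambda f F x : R :=
  Num.sqrt (- ((grad (fine \o f) x)^T *m rnm_dir f F x) 0 0).

Definition rnm_step kappa f F x : 'cV[R]_n :=
  x + (1 + kappa * rnm_lambda f F x)^-1 *: rnm_dir f F x.

Definition rnm kappa f F (x0 : 'cV[R]_n) (j : nat) : 'cV[R]_n :=
  iter j (rnm_step kappa f F) x0.

Definition nu f F x : R :=
  Num.sqrt (quad (hess (fine \o (f \+ F)%E) x) (rnm_dir f F x)).

Definition bounded_below f : Prop := exists m : R, forall x, (m%:E <= f x)%E.

(* f x - inf f, a real number when f is bounded below and x is in dom f *)
Definition gap f x : R := fine (f x) - fine (ereal_inf (range f)).

Definition Gamma kappa f x : R :=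
  sup [set t : R | 0 <= t /\ t - ln (1 + t) <= kappa ^+ 2 * gap f x].

End ExtendedFunctions.

(* Main.v *)
Require Import Defs.
From HB Require Import structures.
From mathcomp Require Import all_boot all_order all_algebra.
From mathcomp Require Import all_classical all_reals all_analysis.
From mathcomp Require Import ring lra.

Set Implicit Arguments.
Unset Strict Implicit.
Unset Printing Implicit Defensive.

Import Order.TTheory GRing.Theory Num.Theory.
Import numFieldNormedType.Exports.

Local Open Scope classical_set_scope.
Local Open Scope ring_scope.

(** Write g = f + F, and let d and lambda be the Newton direction and the
    decrement at x, so that Df(x)[d] = - lambda^2 and the g-Hessian norm of d
    is lambda (nuE: nu and lambda are the same number).

    The argument bounds f from above along the step by bounding its two parts
    separately: f = g - F, where g is self-concordant and F is convex.  Along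
    the ray x + t d, self-concordance says that the function
    psi''(t)^(-1/2) + kappa t is nondecreasing, psi being the restriction of g;
    the resulting bound on psi'', integrated twice, gives
    [[
      g(x + s d) <= g(x) + s Dg(x)[d]
                    - (kappa lambda s + ln (1 - kappa lambda s)) / kappa^2
    ]]
    as long as kappa lambda s < 1 (self_concordant_upper_bound), and because g
    is closed this finite bound also prevents the ray from leaving the domain
    (dikin_dom).  The convex part satisfies F(x + s d) >= F(x) + s DF(x)[d]
    (chord_ge_tangent).  Subtracting cancels the linear terms of F, and with
    s = 1 / (1 + kappa lambda) what is left is, for u = kappa lambda,
    [[
      u - ln (1 + u) <= kappa^2 (f(x) - f(x + s d))      (rnm_step_descent).
    ]]

    So f decreases along the iterates, and u - ln (1 + u) never exceeds
    kappa^2 (f(x0) - inf f), which means u <= Gamma (Gamma_ge).  Since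
    u - ln (1 + u) >= u^2 / (2 (1 + u)) (omega_ge_quadratic), every step gains
    at least lambda^2 / (2 (1 + Gamma)).  The gains telescope to at most
    f(x0) - inf f, and the smallest of k + 1 values of lambda^2 is at most their
    average. *)

(** * Derivative rules for pointwise expressions *)

(** These forms match goals written with a bound variable rather than with the
    operations of the ring of functions. *)
Section PointwiseRules.
Context {R : realType}.
Implicit Types (phi psi : R -> R) (t a b c : R).

Lemma is_derive_funD phi psi t a b :
  is_derive t (1 : R) phi a -> is_derive t (1 : R) psi b ->
  is_derive t (1 : R) (fun s => phi s + psi s) (a + b).
Proof. exact: is_deriveD. Qed.

Lemma is_derive_funB phi psi t a b :
  is_derive t (1 : R) phi a -> is_derive t (1 : R) psi b ->
  is_derive t (1 : R) (fun s => phi s - psi s) (a - b).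
Proof. exact: is_deriveB. Qed.

Lemma is_derive_funM phi psi t a b :
  is_derive t (1 : R) phi a -> is_derive t (1 : R) psi b ->
  is_derive t (1 : R) (fun s => phi s * psi s) (phi t * b + psi t * a).
Proof. exact: is_deriveM. Qed.

Lemma is_derive_funZ phi t a c :
  is_derive t (1 : R) phi a -> is_derive t (1 : R) (fun s => c * phi s) (c * a).
Proof. exact: is_deriveZ. Qed.

Lemma is_derive_funV phi t a :
  phi t != 0 -> is_derive t (1 : R) phi a ->
  is_derive t (1 : R) (fun s => (phi s)^-1) (- a / phi t ^+ 2).
Proof.
move=> n0 D; apply: is_derive_eq (is_deriveV n0 D) _.
by rewrite /GRing.scale /= !mulNr mulrC.
Qed.

Lemma is_derive_fun_ln phi t a :
  0 < phi t -> is_derive t (1 : R) phi a ->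
  is_derive t (1 : R) (fun s => ln (phi s)) (a / phi t).
Proof.
move=> p0 D; apply: is_derive_eq (is_derive1_comp (is_derive1_ln p0) D) _.
exact: mulrC.
Qed.

Lemma is_derive_fun_sqrt phi t a :
  0 < phi t -> is_derive t (1 : R) phi a ->
  is_derive t (1 : R) (fun s => Num.sqrt (phi s)) (a / (2 * Num.sqrt (phi t))).
Proof.
move=> p0 D; apply: is_derive_eq (is_derive1_comp (is_derive1_sqrt p0) D) _.
exact: mulrC.
Qed.

Lemma is_derive_affine a b t : is_derive t (1 : R) (fun s => a + b * s) b.
Proof.
apply: is_derive_eq (is_derive_funD (is_derive_cst a t 1)
  (is_derive_funZ b (is_derive_id t 1))) _.
by rewrite add0r mulr1.
Qed.

End PointwiseRules.

(** * One-variable estimates *)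

Lemma le_of_derive_ge0 (R : realType) (phi dphi : R -> R) (a b : R) :
  a <= b ->
  (forall t, a <= t <= b -> is_derive t (1 : R) phi (dphi t)) ->
  (forall t, a <= t <= b -> 0 <= dphi t) ->
  phi a <= phi b.
Proof.
move=> ab Hd H0.
apply: (@ger0_derive1_ndecr R phi a b) => // [t|t|].
- rewrite in_itv /= => /andP[h1 h2].
  have tab : a <= t <= b by rewrite (ltW h1) (ltW h2).
  have ? := Hd t tab; exact: ex_derive.
- rewrite in_itv /= => /andP[h1 h2].
  have tab : a <= t <= b by rewrite (ltW h1) (ltW h2).
  have ? := Hd t tab.
  by rewrite derive1E derive_val H0.
- apply: derivable_within_continuous => t; rewrite in_itv /= => tab.
  have ? := Hd t tab; exact: ex_derive.
Qed.

(** Both sides vanish at 0, and the difference has derivative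
    t^2 / (2 (1 + t)^2). *)
Lemma omega_ge_quadratic (R : realType) (u : R) :
  0 <= u -> u ^+ 2 / (2 * (1 + u)) <= u - ln (1 + u).
Proof.
move=> u0.
(* The affine subterms are kept in the form a + b t so that is_derive_affine
   applies to them. *)
pose q (t : R) := (0 + 1 * t) - ln (1 + 1 * t) - t * t / (2 + 2 * t).
pose dq (t : R) := t ^+ 2 / (2 * (1 + t) ^+ 2).
have := @le_of_derive_ge0 R q dq 0 u u0.
have -> : q 0 = 0 by rewrite /q !mulr0 !addr0 ln1 mul0r !subr0.
have -> : q u = u - ln (1 + u) - u ^+ 2 / (2 * (1 + u)).
  by rewrite /q !mul1r add0r expr2 mulrDr mulr1.
rewrite subr_ge0; apply=> t /andP[t0 _]; last first.
  by rewrite /dq divr_ge0 ?sqr_ge0 // mulr_ge0 // sqr_ge0.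
have t1 : 0 < 1 + t by rewrite ltr_pwDl.
have p1 : 0 < 1 + 1 * t by rewrite mul1r.
have p2 : 2 + 2 * t != 0 by rewrite gt_eqF //; lra.
have Dln := @is_derive_fun_ln _ (fun r => 1 + 1 * r) _ _ p1 (is_derive_affine _ _ _).
have Dinv := @is_derive_funV _ (fun r => 2 + 2 * r) _ _ p2 (is_derive_affine _ _ _).
have Dsq := is_derive_funM (is_derive_id t (1 : R)) (is_derive_id t (1 : R)).
have D := is_derive_funB (is_derive_funB (is_derive_affine 0 1 t) Dln)
  (is_derive_funM Dsq Dinv).
apply: (is_derive_eq D).
rewrite /dq; field.
by rewrite p2 gt_eqF.
Qed.

(** Self-concordance on a segment [0, s]: psi1, psi2 and psi3 are the successive
    derivatives of psi.  Each lemma below integrates the previous one; the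
    condition kappa lambda s < 1 keeps the comparison function, which blows up
    at 1 / (kappa lambda), finite on the segment. *)
Section SelfConcordantOnSegment.
Context {R : realType}.
Variables (kappa s : R) (psi psi1 psi2 psi3 : R -> R).
Hypotheses (kappa_gt0 : 0 < kappa) (s_ge0 : 0 <= s).
Hypotheses
  (Dpsi : forall t, 0 <= t <= s -> is_derive t (1 : R) psi (psi1 t))
  (Dpsi1 : forall t, 0 <= t <= s -> is_derive t (1 : R) psi1 (psi2 t))
  (Dpsi2 : forall t, 0 <= t <= s -> is_derive t (1 : R) psi2 (psi3 t))
  (psi2_gt0 : forall t, 0 <= t <= s -> 0 < psi2 t)
  (psi3_le : forall t, 0 <= t <= s ->
     psi3 t <= 2 * kappa * Num.sqrt (psi2 t) ^+ 3).

Let lambda := Num.sqrt (psi2 0).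

Hypothesis short : kappa * lambda * s < 1.

Let lambda_gt0 : 0 < lambda.
Proof. by rewrite sqrtr_gt0 psi2_gt0 // lexx. Qed.

Let den_gt0 t : t <= s -> 0 < 1 + - (kappa * lambda) * t.
Proof.
move=> ts; rewrite mulNr subr_gt0; apply: le_lt_trans short.
by rewrite ler_pM2l // mulr_gt0.
Qed.

(** The derivative of psi2^(-1/2) is - psi3 / (2 psi2^(3/2)) >= - kappa, so
    psi2(t)^(-1/2) >= 1 / lambda - kappa t, which is inverted here. *)
Lemma segment_sqrt_le t : 0 <= t <= s ->
  Num.sqrt (psi2 t) <= lambda / (1 - kappa * lambda * t).
Proof.
case/andP=> t0 ts.
pose p r := (Num.sqrt (psi2 r))^-1 + (0 + kappa * r).
have sub r : 0 <= r <= t -> 0 <= r <= s.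
  by case/andP=> -> /le_trans ->.
have sq r : 0 <= r <= t -> 0 < Num.sqrt (psi2 r).
  by move=> /sub /psi2_gt0; rewrite sqrtr_gt0.
have /= := @le_of_derive_ge0 R p
  (fun r => - (psi3 r / (2 * Num.sqrt (psi2 r))) / Num.sqrt (psi2 r) ^+ 2 + kappa) 0 t t0.
rewrite /p mulr0 !addr0 -/lambda add0r => H.
have {H} : lambda^-1 <= (Num.sqrt (psi2 t))^-1 + kappa * t.
  apply: H => r rt.
    apply: is_derive_funD (is_derive_affine _ _ _).
    apply: is_derive_funV; first by rewrite gt_eqF // sq.
    by apply: is_derive_fun_sqrt; [exact/psi2_gt0/sub | exact/Dpsi2/sub].
  have y0 := sq _ rt; have := psi3_le (sub _ rt).
  move: y0; set y := Num.sqrt _ => y0 h3.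
  have -> : - (psi3 r / (2 * y)) / y ^+ 2 + kappa
      = (2 * kappa * y ^+ 3 - psi3 r) / (2 * y ^+ 3).
    by field; rewrite gt_eqF.
  by rewrite divr_ge0 ?subr_ge0 // mulr_ge0 // exprn_ge0 // ltW.
have y0 : 0 < Num.sqrt (psi2 t) by apply: sq; rewrite t0 lexx.
have := den_gt0 ts; rewrite mulNr => d0.
rewrite -lerBlDr -(@lef_pV2 _ (lambda / _)) ?posrE ?divr_gt0 // invf_div.
by apply: le_trans; rewrite mulrBl mul1r mulrAC mulfK ?gt_eqF.
Qed.

(** The right-hand side has derivative lambda^2 / (1 - kappa lambda t)^2, which
    dominates psi2. *)
Lemma segment_derive_le t : 0 <= t <= s ->
  psi1 t <= psi1 0 + lambda ^+ 2 * t / (1 - kappa * lambda * t).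
Proof.
case/andP=> t0 ts.
have sub r : 0 <= r <= t -> 0 <= r <= s.
  by case/andP=> -> /le_trans ->.
pose q r := ((0 + lambda ^+ 2 * r) * (1 + - (kappa * lambda) * r)^-1) - psi1 r.
have /= := @le_of_derive_ge0 R q
  (fun r => (lambda / (1 - kappa * lambda * r)) ^+ 2 - psi2 r) 0 t t0.
rewrite /q !mulr0 addr0 mul0r !add0r mulNr => H.
rewrite addrC -lerBlDr -lerBrDl; apply: H => r rt.
  have d0 : 0 < 1 + - (kappa * lambda) * r.
    by apply: den_gt0; case/andP: rt => _ /le_trans ->.
  have Dinv := @is_derive_funV _ (fun r => 1 + - (kappa * lambda) * r) _ _
    (lt0r_neq0 d0) (is_derive_affine _ _ _).
  have D := is_derive_funB (is_derive_funM (is_derive_affine 0 (lambda ^+ 2) r) Dinv)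
    (Dpsi1 (sub _ rt)).
  apply: (is_derive_eq D).
  by field; rewrite -mulNr gt_eqF.
have rs := sub _ rt.
rewrite subr_ge0 -[X in X <= _]sqr_sqrtr ?(ltW (psi2_gt0 rs)) //.
have le := segment_sqrt_le rs.
by rewrite lerXn2r ?nnegrE ?sqrtr_ge0 ?(le_trans _ le) ?sqrtr_ge0.
Qed.

(** The primitive of lambda^2 t / (1 - kappa lambda t) vanishing at 0 is
    - (kappa lambda t + ln (1 - kappa lambda t)) / kappa^2. *)
Lemma segment_upper_bound :
  psi s <= psi 0 + psi1 0 * s
    - (kappa * lambda * s + ln (1 - kappa * lambda * s)) / kappa ^+ 2.
Proof.
pose q r := (0 + psi1 0 * r)
  - kappa ^- 2 * ((0 + kappa * lambda * r) + ln (1 + - (kappa * lambda) * r)) - psi r.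
have /= := @le_of_derive_ge0 R q
  (fun r => psi1 0 + lambda ^+ 2 * r / (1 - kappa * lambda * r) - psi1 r) 0 s s_ge0.
rewrite /q !mulr0 !addr0 ln1 !add0r mulr0 oppr0 add0r mulNr => H.
have {}H : - psi 0 <= psi1 0 * s
    - kappa ^- 2 * (kappa * lambda * s + ln (1 - kappa * lambda * s)) - psi s.
  apply: H => r rs; last by rewrite subr_ge0 segment_derive_le.
  have d0 : 0 < 1 + - (kappa * lambda) * r.
    by apply: den_gt0; case/andP: rs.
  have Dln := @is_derive_fun_ln _ (fun r => 1 + - (kappa * lambda) * r) _ _
    d0 (is_derive_affine _ _ _).
  have D := is_derive_funB (is_derive_funB (is_derive_affine 0 (psi1 0) r)
    (is_derive_funZ (kappa ^- 2)
       (is_derive_funD (is_derive_affine 0 (kappa * lambda) r) Dln)))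
    (Dpsi rs).
  apply: (is_derive_eq D).
  by field; rewrite -mulNr !gt_eqF.
move: H; rewrite [X in _ - X - _]mulrC; lra.
Qed.
End SelfConcordantOnSegment.

(** * Directional derivatives and Hessians *)

Section DirectionalDerivatives.
Context {R : realType} {n : nat}.
Implicit Types (U : set 'cV[R]_n) (h : 'cV[R]_n -> R) (x v : 'cV[R]_n).

Lemma line_continuous x v : continuous (fun t : R => x + t *: v).
Proof.
by move=> t; apply: cvgD; [exact: cvg_cst | apply: cvgZr_tmp; exact: cvg_id].
Qed.

Lemma is_derive_line h x v t : differentiable h (x + t *: v) ->
  is_derive t (1 : R) (fun r => h (x + r *: v)) ('D_v h (x + t *: v)).
Proof.
move=> /(@diff_derivable _ _ _ h _ v) hd.
have E : (fun e : R => e^-1 *: (((fun r => h (x + r *: v)) \o shift t) (e *: (1 : R))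
             - h (x + t *: v)))
    = (fun e : R => e^-1 *: ((h \o shift (x + t *: v)) (e *: v) - h (x + t *: v))).
  apply/funext => e /=; congr (_ *: (h _ - _)).
  have -> : e *: (1 : R) = e by exact: mulr1.
  by rewrite scalerDl addrCA.
by split; rewrite /derivable /derive E.
Qed.

Lemma derive_coord h x v : differentiable h x ->
  'D_v h x = \sum_i v i 0 * 'D_(delta_mx i 0) h x.
Proof.
move=> hd; rewrite deriveE // {1}[v]matrix_sum_delta linear_sum.
apply: eq_bigr => i _; rewrite big_ord1 linearZ /= deriveE //.
Qed.

(** Near x the function 'D_v h is the fixed linear combination
    sum_j v_j 'D_(e_j) h, so deriving once more along v yields the quadratic
    form with the derivatives taken in the same order as in hess. *)
Lemma quad_hess U h x v : open U -> Ck 2 U h -> U x ->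
  quad (hess h x) v = 'D_v ('D_v h) x.
Proof.
move=> Uo [hd hC] Ux.
have dd w : differentiable ('D_w h) x by have [+ _] := hC w; apply.
have E : \forall y \near x, 'D_v h y = (\sum_j (v j 0 \*: 'D_(delta_mx j 0) h)) y.
  near=> y.
  rewrite fct_sumE derive_coord //; apply: hd.
  by near: y; exact: open_nbhs_nbhs.
rewrite (near_eq_derive _ E).
have D j : is_derive x v (v j 0 \*: 'D_(delta_mx j 0) h)
    (v j 0 *: 'D_v ('D_(delta_mx j 0) h) x).
  apply: is_deriveZ; apply: DeriveDef => //; exact: diff_derivable.
rewrite derive_val /quad mxE; apply: eq_bigr => j _.
rewrite mulrC derive_coord // mxE; congr (_ * _); apply: eq_bigr => i _.
by rewrite !mxE.
Unshelve. all: by end_near. Qed.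

Lemma grad_dot h x v : differentiable h x ->
  ((grad h x)^T *m v) 0 0 = 'D_v h x.
Proof.
move=> hd; rewrite derive_coord // mxE; apply: eq_bigr => i _.
by rewrite !mxE mulrC.
Qed.

End DirectionalDerivatives.

(** * Convexity of extended-valued functions *)

Section ExtendedConvexity.
Context {R : realType} {n : nat}.
Implicit Types (f g F : 'cV[R]_n -> \bar R) (x y v : 'cV[R]_n).

Lemma dom_fineK g x : (forall y, g y != -oo%E) -> dom g x -> (fine (g x))%:E = g x.
Proof. by move=> gN gx; rewrite fineK // fin_numE gN /= lt_eqF. Qed.

Lemma fine_convex g x v (s t : R) :
  (forall y, g y != -oo%E) -> econvex g -> dom g x -> dom g (x + s *: v) ->
  0 <= t <= 1 ->
  dom g (x + (t * s) *: v) /\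
  fine (g (x + (t * s) *: v))
    <= (1 - t) * fine (g x) + t * fine (g (x + s *: v)).
Proof.
move=> gN gC gx gy t01; have := gC (x + s *: v) x t t01.
have -> : t *: (x + s *: v) + (1 - t) *: x = x + (t * s) *: v.
  by rewrite scalerDr addrAC -scalerDl addrC scalerA subrKC scale1r addrC.
rewrite -(dom_fineK gN gx) -(dom_fineK gN gy) -!EFinM -EFinD => le.
have gz : dom g (x + (t * s) *: v) by apply: le_lt_trans le _; rewrite ltry.
rewrite -(dom_fineK gN gz) lee_fin in le.
by split => //; rewrite [leRHS]addrC.
Qed.

End ExtendedConvexity.

(** For 0 < t <= 1 the hypothesis bounds the difference quotient
    (h(t s) - h(0)) / t by h(s) - h(0); let t tend to 0. *)
Lemma chord_ge_tangent (R : realType) (h : R -> R) (a s : R) :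
  is_derive (0 : R) (1 : R) h a ->
  (forall t, 0 <= t <= 1 -> h (t * s) <= (1 - t) * h 0 + t * h s) ->
  a * s <= h s - h 0.
Proof.
move=> D hC.
have Dq : is_derive (0 : R) (1 : R) (fun t => h (s * t)) (a * s).
  apply: (@is_derive1_comp _ h (fun t => s * t)); first by rewrite mulr0.
  by have Ds := is_derive_funZ s (is_derive_id (0 : R) (1 : R)); rewrite mulr1 in Ds.
have [dq vq] := Dq.
have /cvg_dnbhs_at_right C : (fun e : R => e^-1 *:
    (((fun t => h (s * t)) \o shift 0) (e *: (1 : R)) - h (s * 0))) @ 0^'
    --> a * s.
  by rewrite -vq.
apply: (cvgr_to_le C); near=> e.
have e0 : 0 < e by near: e; exact: nbhs_right_gt.
have e1 : e <= 1 by near: e; exact: nbhs_right_le.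
have -> : e *: (1 : R) = e by exact: mulr1.
rewrite /= addr0 mulr0 [_ *: _]mulrC ler_pdivrMr //.
have := hC e; rewrite (ltW e0) e1 (mulrC e s) => /(_ isT); lra.
Unshelve. all: by end_near. Qed.

(** A nonzero vector in the kernel would make the quadratic form vanish. *)
Lemma posdef_unitmx (R : realType) (n : nat) (A : 'M[R]_n) : posdef A -> A \in unitmx.
Proof.
move=> Ap; rewrite -row_free_unit -kermx_eq0.
apply/negPn/negP => /rowV0Pn [u /sub_kermxP uA u0].
have uT : u^T != 0 by rewrite trmx_eq0.
by have := Ap _ uT; rewrite /quad trmxK uA mul0mx mxE ltxx.
Qed.

(** * Self-concordant functions along a ray *)

Section SelfConcordance.
Context {R : realType} {n : nat}.
Variables (kappa : R) (g : 'cV[R]_n -> \bar R).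
Hypotheses (kappa_gt0 : 0 < kappa) (g_fin : forall x, g x != -oo%E).
Hypothesis g_sc : self_concordant kappa g.
Hypothesis g_pos : forall x, dom g x -> posdef (hess (fine \o g) x).
Implicit Types (x v : 'cV[R]_n) (s t : R).

Let gr := fine \o g.

Lemma self_concordant_upper_bound x v s : v != 0 -> 0 <= s ->
  dom g x -> dom g (x + s *: v) ->
  kappa * Num.sqrt (quad (hess gr x) v) * s < 1 ->
  gr (x + s *: v) <= gr x + 'D_v gr x * s
    - (kappa * Num.sqrt (quad (hess gr x) v) * s
       + ln (1 - kappa * Num.sqrt (quad (hess gr x) v) * s)) / kappa ^+ 2.
Proof.
move=> v0 s0 gx gs; have [_ gC go gC3 g3] := g_sc.
have gC2 : Ck 2 (dom g) gr.
  case: gC3 => g1 g2; split=> // w; have [h1 h2] := g2 w; split=> // w'.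
  by move=> z gz; have [h3 _] := h2 w'; apply: differentiable_continuous; apply: h3.
have quadE z : dom g z -> quad (hess gr z) v = 'D_v ('D_v gr) z.
  exact: quad_hess.
have seg t : 0 <= t <= s -> dom g (x + t *: v).
  have [->|sn0] := eqVneq s 0.
    by rewrite -eq_le => /eqP <-; rewrite scale0r addr0.
  have sp : 0 < s by rewrite lt0r sn0.
  move=> /andP[t0 ts].
  have t01 : 0 <= t / s <= 1 by rewrite divr_ge0 // ler_pdivrMr // mul1r.
  have [+ _] := fine_convex g_fin gC gx gs t01.
  by rewrite divfK.
case: gC3 => d1 /(_ v) [d2 /(_ v) [d3 _]].
have e0 : x = x + 0 *: v by rewrite scale0r addr0.
have := @segment_upper_bound R kappa s (fun t => gr (x + t *: v))
  (fun t => 'D_v gr (x + t *: v)) (fun t => 'D_v ('D_v gr) (x + t *: v))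
  (fun t => third_derive gr (x + t *: v) v) kappa_gt0 s0.
rewrite /= -e0 -(quadE x gx); apply => t ts.
- exact/is_derive_line/d1/seg.
- exact/is_derive_line/d2/seg.
- exact/is_derive_line/d3/seg.
- by rewrite -quadE; [apply: g_pos => //; apply: seg | apply: seg].
- apply: le_trans (g3 _ v (seg t ts)) _.
  rewrite quadE; last exact: seg.
  have q0 : 0 <= 'D_v ('D_v gr) (x + t *: v).
    by rewrite -quadE; [apply/ltW/g_pos => //; apply: seg | apply: seg].
  by rewrite (mulrC 3) powRrM powR12_sqrt // powR_mulrn ?sqrtr_ge0.
Qed.

(** The ray cannot leave the domain inside the Dikin ellipsoid: on the parameters
    t <= s that stay in the domain, g is bounded by a constant M, so by
    closedness of the epigraph the supremum of these parameters is itself one of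
    them, and by openness of the domain it cannot be smaller than s. *)
Lemma dikin_dom x v s : v != 0 -> 0 <= s -> dom g x ->
  kappa * Num.sqrt (quad (hess gr x) v) * s < 1 ->
  dom g (x + s *: v).
Proof.
move=> v0 s0 gx; set l := kappa * _ => ls; have [gcl gC go _ _] := g_sc.
have l0 : 0 <= l by rewrite mulr_ge0 ?sqrtr_ge0 // ltW.
pose A := [set t : R | 0 <= t <= s /\ dom g (x + t *: v)].
have A0 : A 0 by split; [rewrite lexx | rewrite scale0r addr0].
have As : ubound A s by move=> t [/andP[_ ->]].
have Ane : A !=set0 by exists 0.
have Aub : has_ubound A by exists s.
(* M majorizes, uniformly in t <= s, the bound of self_concordant_upper_bound
   at t. *)
pose M := gr x + `|'D_v gr x| * s - ln (1 - l * s) / kappa ^+ 2.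
have AM t : A t -> epigraph g (x + t *: v, M).
  case=> /andP[t0 ts] gt; rewrite /epigraph /= -(dom_fineK g_fin gt) lee_fin.
  have lts : l * t <= l * s by rewrite ler_wpM2l.
  apply: le_trans (self_concordant_upper_bound v0 t0 gx gt _) _.
    exact: le_lt_trans ls.
  rewrite -/l /M -!addrA lerD2l lerD //.
    by apply: le_trans (ler_norm _) _; rewrite normrM (ger0_norm t0) ler_wpM2l.
  rewrite lerN2 ler_pM2r ?invr_gt0 ?exprn_gt0 //.
  rewrite (@le_trans _ _ (ln (1 - l * t))) //.
    by rewrite ler_ln ?posrE; lra.
  by rewrite lerDr mulr_ge0.
have clT : closed [set t : R | epigraph g (x + t *: v, M)].
  apply: (@preimage_closed _ _ (fun t : R => (x + t *: v, M))) => // t _.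
  exact: (cvg_pair (@line_continuous _ _ x v t) (cvg_cst M)).
have gT : dom g (x + sup A *: v).
  suff : epigraph g (x + sup A *: v, M).
    by rewrite /epigraph /= => /le_lt_trans; apply; rewrite ltry.
  exact/clT/(closure_subset AM)/closure_sup.
have T0 : 0 <= sup A by exact: ub_le_sup.
have Ts : sup A <= s by apply: ge_sup.
move: (Ts); rewrite le_eqVlt => /predU1P[<- //|Tlt].
have : nbhs (sup A) [set t : R | dom g (x + t *: v)].
  exact/line_continuous/open_nbhs_nbhs.
move=> /nbhs_ballP [e /= e0 eA].
have [m0 ms] : 0 < Num.min (e / 2) (s - sup A) /\
    Num.min (e / 2) (s - sup A) <= s - sup A.
  by rewrite lt_min subr_gt0 Tlt divr_gt0 // ge_min lexx orbT.
have me : Num.min (e / 2) (s - sup A) < e.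
  by rewrite gt_min ltr_pdivrMr // ltr_pMr // ltr1n.
move: m0 ms me; set m := Num.min _ _ => m0 ms me.
have /(ub_le_sup Aub) : A (sup A + m).
  split; first by rewrite addr_ge0 ?(ltW m0) //=; lra.
  by apply: eA; rewrite /ball /= opprD addNKr normrN gtr0_norm.
by rewrite gerDl leNgt m0.
Qed.
End SelfConcordance.

(** * Descent of the regularized Newton step *)

Section Descent.
Context {R : realType} {n : nat}.
Variables (kappa : R) (f F : 'cV[R]_n -> \bar R).
Hypotheses (kappa_gt0 : 0 < kappa).
Hypotheses (f_fin : forall x, f x != -oo%E) (F_fin : forall x, F x != -oo%E).
Hypotheses (F_convex : econvex F) (f_C3 : Ck 3 (dom f) (fine \o f)).
Hypothesis f_sc : based_self_concordant kappa F f.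
Implicit Types (x v : 'cV[R]_n) (s t : R).

Let g := (f \+ F)%E.

Let g_fin x : g x != -oo%E.
Proof. by rewrite /g adde_eq_ninfty negb_or f_fin F_fin. Qed.

Let dom_fF x : dom f x -> dom F x.
Proof. by case: f_sc => + _ _; apply. Qed.

Let dom_g x : dom g x <-> dom f x.
Proof.
split; last by move=> fx; rewrite /dom /g /= lte_add_pinfty //; exact: dom_fF.
rewrite /dom /g /=; move: (f_fin x) (F_fin x).
by case: (f x) => // [r|]; case: (F x) => //= *; rewrite ltry.
Qed.

Let fine_g x : dom f x -> (fine \o g) x = fine (f x) + fine (F x).
Proof.
move=> fx; rewrite /g /= -{1}(dom_fineK f_fin fx) -{1}(dom_fineK F_fin (dom_fF fx)).
by rewrite -EFinD.
Qed.

(** Since H d = - grad f, both sides are the scalar - d^T grad f. *)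
Lemma nu_sqr x : dom f x ->
  quad (hess (fine \o g) x) (rnm_dir f F x)
    = - ((grad (fine \o f) x)^T *m rnm_dir f F x) 0 0.
Proof.
move=> fx; have [_ _ g_pos] := f_sc; have Hu := posdef_unitmx (g_pos x fx).
rewrite /quad -mulmxA {2}/rnm_dir mulmxN mulmxA mulmxV // mul1mx mulmxN mxE.
congr (- _); set u := rnm_dir _ _ _; set w := grad _ _.
by rewrite -[w in LHS]trmxK -trmx_mul mxE.
Qed.

Lemma nuE x : dom f x -> nu f F x = rnm_lambda f F x.
Proof. by move=> fx; rewrite /nu nu_sqr. Qed.

(** The gain of one step is the value at u = kappa nu of u - ln (1 + u).  The step
    length s = 1 / (1 + u) makes 1 - u s equal to s, so the logarithm in the upper
    bound of g becomes - ln (1 + u). *)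
Lemma rnm_step_descent x : dom f x ->
  dom f (rnm_step kappa f F x) /\
  kappa * nu f F x - ln (1 + kappa * nu f F x)
    <= kappa ^+ 2 * (fine (f x) - fine (f (rnm_step kappa f F x))).
Proof.
move=> fx; have [_ g_sc g_pos] := f_sc.
have g_posg z : dom g z -> posdef (hess (fine \o g) z) by move=> /dom_g /g_pos.
have gx : dom g x by apply/dom_g.
rewrite /rnm_step -nuE //; set d := rnm_dir f F x; set l := nu f F x.
have [d0|dn0] := eqVneq d 0.
  have -> : l = 0.
    by rewrite /l /nu -/d d0 /quad mulmx0 mxE sqrtr0.
  by rewrite d0 scaler0 addr0 mulr0 addr0 ln1 !subrr mulr0.
have l0 : 0 < l by rewrite sqrtr_gt0 g_pos.
have kl0 : 0 < kappa * l by rewrite mulr_gt0.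
have kl1 : 0 < 1 + kappa * l by rewrite ltr_pwDl // ltW.
set s := (1 + kappa * l)^-1.
have s0 : 0 <= s by rewrite invr_ge0 ltW.
have ls : kappa * Num.sqrt (quad (hess (fine \o g) x) d) * s < 1.
  by rewrite -/(nu f F x) -/l ltr_pdivrMr // mul1r ltrDr.
have gs := dikin_dom kappa_gt0 g_fin g_sc g_posg dn0 s0 gx ls.
have fs : dom f (x + s *: d) by apply/dom_g.
split=> //.
have := self_concordant_upper_bound kappa_gt0 g_fin g_sc g_posg dn0 s0 gx gs ls.
rewrite -/(nu f F x) -/l => ub.
have dg : differentiable (fine \o g) x by case: g_sc => _ _ _ [+ _] _; apply.
have df : differentiable (fine \o f) x by case: f_C3 => + _; apply.
have e0 : x = x + 0 *: d by rewrite scale0r addr0.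
have Dg := @is_derive_line _ _ (fine \o g) x d 0.
have Df := @is_derive_line _ _ (fine \o f) x d 0.
rewrite -e0 in Dg Df.
(* On the domain F coincides with g - f, which is where its derivative comes
   from. *)
have := chord_ge_tangent (is_derive_funB (Dg dg) (Df df)) (s := s).
have fF t : dom f (x + t *: d) ->
    (fine \o g) (x + t *: d) - (fine \o f) (x + t *: d) = fine (F (x + t *: d)).
  by move=> ft; rewrite fine_g //= addrC addKr.
rewrite (fF s fs) (fF 0) -?e0 // => tangent.
have {}tangent : ('D_d (fine \o g) x - 'D_d (fine \o f) x) * s
    <= fine (F (x + s *: d)) - fine (F x).
  apply: tangent => t t01.
  have gt : dom g (x + (t * s) *: d).
    by have [_ gC _ _ _] := g_sc; have [] := fine_convex g_fin gC gx gs t01.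
  rewrite fF; last exact/dom_g.
  by have [] := fine_convex F_fin F_convex (dom_fF fx) (dom_fF fs) t01.
have Dfl : 'D_d (fine \o f) x = - l ^+ 2.
  rewrite -grad_dot // -[LHS]opprK -nu_sqr // -/d /l /nu -/d sqr_sqrtr //.
  exact/ltW/g_pos.
rewrite !fine_g // Dfl in ub tangent.
have e1 : 1 - kappa * l * s = s by rewrite /s; field; rewrite gt_eqF.
rewrite e1 /s lnV ?posrE // -/s in ub.
have k2 : 0 < kappa ^+ 2 by rewrite exprn_gt0.
have {}ub : fine (f (x + s *: d)) <= fine (f x) - l ^+ 2 * s
    - (kappa * l * s - ln (1 + kappa * l)) / kappa ^+ 2 by lra.
have : kappa ^+ 2 * (l ^+ 2 * s
    + (kappa * l * s - ln (1 + kappa * l)) / kappa ^+ 2)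
    <= kappa ^+ 2 * (fine (f x) - fine (f (x + s *: d))).
  by rewrite ler_wpM2l ?(ltW k2) //; lra.
apply: le_trans; rewrite le_eqVlt; apply/orP; left; apply/eqP.
by rewrite /s; field; rewrite !gt_eqF.
Qed.

End Descent.

(** * Sublevel set and initial gap *)

(** The set whose supremum is Gamma is bounded above, because for r > 1
    r - ln (1 + r) >= r^2 / (2 (1 + r)) >= r / 4. *)
Lemma Gamma_ge (R : realType) (n : nat) (kappa : R) (f : 'cV[R]_n -> \bar R) x (t : R) :
  0 <= t -> t - ln (1 + t) <= kappa ^+ 2 * gap f x -> t <= Gamma kappa f x.
Proof.
move=> t0 tc; apply: (@ub_le_sup R) => //; set c := kappa ^+ 2 * _ in tc *.
exists (1 + 4 * `|c|) => r [r0 rc].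
have c0 := normr_ge0 c; have cc := ler_norm c.
have [r1|r1] := leP r 1; first lra.
have := le_trans (omega_ge_quadratic r0) rc.
by rewrite ler_pdivrMr; nra.
Qed.

Lemma gap_ge0 (R : realType) (n : nat) (f : 'cV[R]_n -> \bar R) x :
  (forall y, f y != -oo%E) -> bounded_below f -> dom f x -> 0 <= gap f x.
Proof.
move=> f_fin [m mf] fx.
have fi : (ereal_inf (range f) <= f x)%E by apply: ereal_inf_lbound; exists x.
have mi : (m%:E <= ereal_inf (range f))%E by apply: le_ereal_inf_tmp => _ [y _ <-].
rewrite subr_ge0 fine_le //.
  rewrite fin_numE -ltNye (lt_le_trans _ mi) ?ltNyr //=.
  by rewrite lt_eqF // (le_lt_trans fi).
by rewrite fin_numE f_fin lt_eqF.
Qed.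

(** * The convergence rate *)

Theorem theorem3p2 (R : realType) (n : nat) (kappa : R)
    (f F : 'cV[R]_n -> \bar R) (x0 : 'cV[R]_n) :
  0 < kappa ->
  (forall x, f x != -oo%E) ->
  (forall x, F x != -oo%E) ->
  econvex F ->
  Ck 3 (dom f) (fine \o f) ->
  bounded_below f ->
  based_self_concordant kappa F f ->
  dom f x0 ->
  forall k : nat,
    \big[Num.min/nu f F (rnm kappa f F x0 0)]_(j < k.+1)
        nu f F (rnm kappa f F x0 j)
      <= Num.sqrt (2 * (1 + Gamma kappa f x0) * gap f x0 / k.+1%:R).
Proof.
move=> k0 f_fin F_fin F_convex f_C3 f_bb f_sc fx0 k.
pose x := rnm kappa f F x0.
have step j : dom f (x j) ->
    dom f (x j.+1) /\ kappa * nu f F (x j) - ln (1 + kappa * nu f F (x j))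
      <= kappa ^+ 2 * (fine (f (x j)) - fine (f (x j.+1))).
  exact: rnm_step_descent.
have xdom j : dom f (x j) by elim: j => // j /step[].
have kn0 j : 0 <= kappa * nu f F (x j) by rewrite mulr_ge0 ?sqrtr_ge0 // ltW.
have k2 : 0 < kappa ^+ 2 by rewrite exprn_gt0.
have dec j : fine (f (x j.+1)) <= fine (f (x j)).
  rewrite -subr_ge0 -(pmulr_rge0 _ k2); apply: le_trans (step j (xdom j)).2.
  apply: le_trans (omega_ge_quadratic (kn0 j)).
  by rewrite divr_ge0 ?sqr_ge0 // mulr_ge0 // addr_ge0.
have gapE j : fine (f (x0)) - fine (f (x j)) <= gap f x0.
  by rewrite /gap lerD2l lerN2 -subr_ge0 gap_ge0.
have dec0 j : fine (f (x j)) <= fine (f x0).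
  by elim: j => // j /(le_trans (dec j)).
have nuG j : kappa * nu f F (x j) <= Gamma kappa f x0.
  apply: Gamma_ge => //; apply: le_trans (step j (xdom j)).2 _.
  by rewrite ler_pM2l //; have := gapE j.+1; have := dec0 j; lra.
have G0 : 0 <= Gamma kappa f x0 by apply: le_trans (nuG 0%N).
have nu2 j : nu f F (x j) ^+ 2
    <= 2 * (1 + Gamma kappa f x0) * (fine (f (x j)) - fine (f (x j.+1))).
  have := le_trans (omega_ge_quadratic (kn0 j)) (step j (xdom j)).2.
  rewrite exprMn -[leLHS]mulrA ler_pM2l // ler_pdivrMr; last first.
    by rewrite mulr_gt0 // ltr_pwDl.
  move=> /le_trans; apply; rewrite mulrC; apply: ler_wpM2r.
    by rewrite subr_ge0 dec.
  by rewrite ler_pM2l // lerD2l.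
set m := \big[_/_]_(_ < _) _.
have m0 : 0 <= m by apply: le_bigmin => *; exact: sqrtr_ge0.
have mle (j : 'I_k.+1) : m <= nu f F (x j) by apply: bigmin_le.
rewrite -(ger0_norm m0) -sqrtr_sqr ler_wsqrtr // ler_pdivlMr ?ltr0n //.
have -> : m ^+ 2 * k.+1%:R = \sum_(j < k.+1) m ^+ 2.
  by rewrite sumr_const card_ord mulr_natr.
apply: (@le_trans _ _ (\sum_(j < k.+1) (2 * (1 + Gamma kappa f x0) *
    (fine (f (x j)) - fine (f (x j.+1)))))).
  apply: ler_sum => j _; apply: le_trans (nu2 j).
  by rewrite lerXn2r ?nnegrE ?mle // (le_trans m0).
rewrite -mulr_sumr ler_wpM2l //; first by rewrite mulr_ge0 // addr_ge0.
rewrite -(big_mkord xpredT (fun j => fine (f (x j)) - fine (f (x j.+1)))).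
have -> : \sum_(0 <= j < k.+1) (fine (f (x j)) - fine (f (x j.+1)))
    = fine (f x0) - fine (f (x k.+1)); last exact: gapE.
under eq_bigr do rewrite -opprB.
by rewrite sumrN (telescope_sumr (fun j => fine (f (x j)))) // opprB.
Qed.
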